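(* Let $\gamma=(t,r,\theta,\phi):I\to\mathcal M$ be a (time-like or light-like) geodesic, i.e. the trajectory of a test particle of electric charge $e\in\mathbb R$, in the Kerr--Newman--(anti) de Sitter spacetime, with values in $\{\Sigma\Delta_r\sin\theta\neq0\}$. Then its energy $E$, angular momentum $L$ and Carter constant $\kappa$ are given as follows: $$E=-\frac{eQr}{\chi\Sigma}+\frac1\chi\sqrt{(a^2\sin^2\theta\,\Delta_\theta-\Delta_r)\left(\frac{\mu}{\Sigma}-\frac{\dot r^2}{\Delta_r}-\frac{\dot\theta^2}{\Delta_\theta}\right)+\frac{\dot\phi^2\sin^2\theta\,\Delta_r\Delta_\theta}{\chi^2}},$$ $$L=\frac{\sin^2\theta}{\chi^2(\Delta_r-a^2\sin^2\theta\,\Delta_\theta)}\left[aE\chi^2\Delta_r+\Delta_\theta\left(\Sigma\Delta_r\dot\phi-a\chi\big(\chi E(r^2+a^2)+eQr\big)\right)\right],$$ $$\kappa=\frac{W_\theta^2+\Sigma^2\dot\theta^2}{\Delta_\theta}-\mu a^2\cos^2\theta=\frac{W_r^2-\Sigma^2\dot r^2}{\Delta_r}+\mu r^2,$$ where $W_r:=\chi(E(r^2+a^2)-aL)+eQr$, $W_\theta:=\chi(aE\sin\theta-L/\sin\theta)$, and where $\mu=-1$ for a massive test particle and $\mu=0$ for a photon.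
   Context: Kerr--Newman--(anti) de Sitter (KNdS) spacetime: $\mathcal M=\mathbb R^2\times\mathbb S^2$ with Boyer--Lindquist coordinates $(t,r,\theta,\phi)$, where $(\theta,\phi)$ are spherical coordinates on $\mathbb S^2$. Fix constants $\Lambda\in\mathbb R$, $M,Q,J\ge 0$, and set $a:=J/M$ if $M\ne0$, $a:=J$ otherwise; $\lambda:=\Lambda/3$, $\chi:=1+\lambda a^2$ (assumed $\neq0$), and $$\Sigma:=r^2+a^2\cos^2\theta,\quad \Delta_r:=(1-\lambda r^2)(r^2+a^2)-2Mr+Q^2,\quad \Delta_\theta:=1+\lambda a^2\cos^2\theta.$$ On $\{\Sigma\Delta_r\Delta_\theta\sin\theta\neq0\}$ the metric $g$ (signature $(-,+,+,+)$, units $G=c=4\pi\epsilon_0=1$) is $$\mathrm ds^2=-\frac{\Delta_r}{\chi^2\Sigma}(\mathrm dt-a\sin^2\theta\,\mathrm d\phi)^2+\frac{\Delta_\theta\sin^2\theta}{\chi^2\Sigma}(a\,\mathrm dt-(r^2+a^2)\mathrm d\phi)^2+\Sigma\left(\frac{\mathrm dr^2}{\Delta_r}+\frac{\mathrm d\theta^2}{\Delta_\theta}\right).$$ The electromagnetic vector potential is $A=\frac{Qr}{\chi\Sigma}(\mathrm dt-a\sin^2\theta\,\mathrm d\phi)$, and $F_{\mu\nu}=\partial_\mu A_\nu-\partial_\nu A_\mu$. The trajectory (''geodesic'') of a test particle of charge $e$ is a solution, on an open interval $I$ with affine parameter $\ell$ (dot $=\mathrm d/\mathrm d\ell$), of $\ddot\gamma^\mu+\Gamma^\mu{}_{\alpha\beta}\dot\gamma^\alpha\dot\gamma^\beta=eF^\mu{}_\alpha\dot\gamma^\alpha$,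 with $\Gamma^\mu{}_{\alpha\beta}$ the Christoffel symbols of $g$. The conjugate momenta are $p_\mu:=g_{\mu\nu}\dot\gamma^\nu+eA_\mu$. The constants of motion are: - $\mu:=g^{\alpha\beta}(p_\alpha-eA_\alpha)(p_\beta-eA_\beta)$ (twice the Hamiltonian); - the total energy $E:=-p_t$ and the total azimuthal angular momentum $L:=p_\phi$; - the Carter constant $\kappa:=\Delta_\theta p_\theta^2+\frac{W_\theta^2}{\Delta_\theta}-\mu a^2\cos^2\theta=-\Delta_r p_r^2+\frac{W_r^2}{\Delta_r}+\mu r^2$ (the two expressions agree and are constant along $\gamma$).
   Formalization: The formula for E is stated with + when -χg(∂_t,γ') ≥ 0 and with - before the root otherwise (the printed + fails for past-directed trajectories, e.g. in Minkowski space); the formula for L is stated where its denominator is nonzero; Δ_θ≠0 is assumed, as the metric requires. *)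

(* Defs.v *)
From HB Require Import structures.
From mathcomp Require Import all_boot all_order all_algebra.
From mathcomp Require Import all_classical all_reals all_analysis.

Set Implicit Arguments.
Unset Strict Implicit.
Unset Printing Implicit Defensive.

Import Order.TTheory GRing.Theory Num.Theory.
Import numFieldNormedType.Exports.

Local Open Scope classical_set_scope.
Local Open Scope ring_scope.

(* Everything is written in the Boyer-Lindquist chart (t, r, theta, phi):      *)
(* points, tangent vectors and covectors are row vectors of R^4 (geometrized   *)
(* units, G = c = 4 pi epsilon_0 = 1).  Along a curve phi is the lifted        *)
(* (R-valued) angle, and theta is only constrained by sin theta != 0.          *)
Definition it : 'I_4 := @Ordinal 4 0 isT.
Definition ir : 'I_4 := @Ordinal 4 1 isT.
Definition ith : 'I_4 := @Ordinal 4 2 isT.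
Definition iph : 'I_4 := @Ordinal 4 3 isT.

Record KNdS (R : realType) := MkKNdS {
  bh_cosmo : R;   (* cosmological constant Lambda *)
  bh_mass : R;    (* M *)
  bh_charge : R;  (* Q *)
  bh_angmom : R   (* J *)
}.

Section Spacetime.
Variables (R : realType) (b : KNdS R).

Definition spin : R := if bh_mass b == 0 then bh_angmom b else bh_angmom b / bh_mass b.
Definition lam : R := bh_cosmo b / 3.
Definition chi : R := 1 + lam * spin ^+ 2.

Local Notation a := spin.

Definition Sigma (x : 'rV[R]_4) : R :=
  x 0 ir ^+ 2 + a ^+ 2 * cos (x 0 ith) ^+ 2.

Definition Delta_r (x : 'rV[R]_4) : R :=
  (1 - lam * x 0 ir ^+ 2) * (x 0 ir ^+ 2 + a ^+ 2)
  - 2 * bh_mass b * x 0 ir + bh_charge b ^+ 2.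

Definition Delta_th (x : 'rV[R]_4) : R :=
  1 + lam * a ^+ 2 * cos (x 0 ith) ^+ 2.

(* Where the Boyer-Lindquist expression of the metric makes sense. *)
Definition BL_domain : set 'rV[R]_4 :=
  [set x | Sigma x * Delta_r x * Delta_th x * sin (x 0 ith) != 0].

(* The k-th coordinate vector; read as a covector, the k-th coordinate         *)
(* differential, so that basis it is the vector d/dt and the one-form dt.      *)
Definition basis (k : 'I_4) : 'rV[R]_4 := delta_mx 0 k.

Definition form1 (x : 'rV[R]_4) : 'rV[R]_4 :=
  basis it - (a * sin (x 0 ith) ^+ 2) *: basis iph.

Definition form2 (x : 'rV[R]_4) : 'rV[R]_4 :=
  a *: basis it - (x 0 ir ^+ 2 + a ^+ 2) *: basis iph.

(* The Gram matrix of the quadratic form (w)^2. *)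
Definition square_form (w : 'rV[R]_4) : 'M[R]_4 := w^T *m w.

Definition metric (x : 'rV[R]_4) : 'M[R]_4 :=
  - (Delta_r x / (chi ^+ 2 * Sigma x)) *: square_form (form1 x)
  + (Delta_th x * sin (x 0 ith) ^+ 2 / (chi ^+ 2 * Sigma x))
      *: square_form (form2 x)
  + Sigma x *: ((Delta_r x)^-1 *: square_form (basis ir)
                + (Delta_th x)^-1 *: square_form (basis ith)).

Definition cometric (x : 'rV[R]_4) : 'M[R]_4 := invmx (metric x).

Definition metric_dot (x u v : 'rV[R]_4) : R :=
  \sum_m \sum_n metric x m n * u 0 m * v 0 n.

Definition potential (x : 'rV[R]_4) : 'rV[R]_4 :=
  (bh_charge b * x 0 ir / (chi * Sigma x)) *: form1 x.

Definition partial (k : 'I_4) (f : 'rV[R]_4 -> R) (x : 'rV[R]_4) : R :=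
  'D_(basis k) f x.

Definition christoffel (x : 'rV[R]_4) (m al be : 'I_4) : R :=
  2^-1 * \sum_n cometric x m n *
    (partial al (fun y => metric y n be) x
     + partial be (fun y => metric y n al) x
     - partial n (fun y => metric y al be) x).

Definition faraday (x : 'rV[R]_4) (m n : 'I_4) : R :=
  partial m (fun y => potential y 0 n) x
  - partial n (fun y => potential y 0 m) x.

(* F^m_al *)
Definition faraday_up (x : 'rV[R]_4) (m al : 'I_4) : R :=
  \sum_n cometric x m n * faraday x n al.

(* Trajectory, on the parameter set I, of a test particle of charge e.         *)
Definition trajectory (e : R) (I : set R) (gam : R -> 'rV[R]_4) : Prop :=
  forall l, I l ->
    [/\ BL_domain (gam l),
        derivable gam l 1,
        derivable (derive1 gam) l 1 &
        forall m : 'I_4,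
          derive1 (derive1 gam) l 0 m
          + \sum_al \sum_be christoffel (gam l) m al be
                            * derive1 gam l 0 al * derive1 gam l 0 be
          = e * \sum_al faraday_up (gam l) m al * derive1 gam l 0 al].

(* In the definitions below x is the position and v the velocity.              *)

Definition momentum (e : R) (x v : 'rV[R]_4) : 'rV[R]_4 :=
  \row_m (\sum_n metric x m n * v 0 n + e * potential x 0 m).

(* The constant of motion mu (twice the Hamiltonian). *)
Definition two_ham (e : R) (x v : 'rV[R]_4) : R :=
  \sum_al \sum_be cometric x al be
    * (momentum e x v 0 al - e * potential x 0 al)
    * (momentum e x v 0 be - e * potential x 0 be).

Definition energy (e : R) (x v : 'rV[R]_4) : R := - momentum e x v 0 it.

Definition ang_momentum (e : R) (x v : 'rV[R]_4) : R := momentum e x v 0 iph.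

Definition W_r (e E L : R) (x : 'rV[R]_4) : R :=
  chi * (E * (x 0 ir ^+ 2 + a ^+ 2) - a * L) + e * bh_charge b * x 0 ir.

Definition W_th (E L : R) (x : 'rV[R]_4) : R :=
  chi * (a * E * sin (x 0 ith) - L / sin (x 0 ith)).

(* The Carter constant, through its polar expression. *)
Definition carter (e : R) (x v : 'rV[R]_4) : R :=
  Delta_th x * momentum e x v 0 ith ^+ 2
  + W_th (energy e x v) (ang_momentum e x v) x ^+ 2 / Delta_th x
  - two_ham e x v * a ^+ 2 * cos (x 0 ith) ^+ 2.

(* Time orientation.  - g(d/dt, v) is the kinetic part E + e A_t of the        *)
(* energy.  For chi > 0 its nonnegativity says, wherever d/dt is timelike,     *)
(* that the causal vector v points to the same future as d/dt.  Reversing a    *)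
(* trajectory (l -> -l, e -> -e) changes the sign of g(d/dt, v).               *)
Definition future_oriented (x v : 'rV[R]_4) : Prop :=
  0 <= chi * - metric_dot x (basis it) v.

End Spacetime.

(* Main.v *)
(* Everything is pointwise.  In the frame [u1 = form1 v], [u2 = form2 v], [rdot],
   [thdot] the metric is diagonal, so lowering an index is explicit, the
   gauge terms cancel in [W_r = Delta_r * u1 / chi] and
   [W_th = Delta_th * sin th * u2 / chi], and [Sigma * phdot = a * u1 - u2]
   turns the radicand into the square of [- chi * g(d/dt, v)]. *)
Require Import Defs.
From mathcomp Require Import all_boot all_order all_algebra.
From mathcomp Require Import ring.
From mathcomp Require Import all_classical all_reals all_analysis.
Import Order.TTheory GRing.Theory Num.Theory.
Import numFieldNormedType.Exports.
Local Open Scope classical_set_scope.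
Local Open Scope ring_scope.

(** * Lowering an index in the frame adapted to the metric *)

Section Frame.
Variables (R : realType) (b : KNdS R).

Definition pairing (w v : 'rV[R]_4) : R := (w *m v^T) 0 0.

Lemma sum4E (F : 'I_4 -> R) : \sum_i F i = F it + F ir + F ith + F iph.
Proof.
rewrite !big_ord_recl big_ord0 addr0 !addrA.
by congr (F _ + F _ + F _ + F _); apply: val_inj.
Qed.

(** The Gram matrix is the rank-one tensor w ⊗ w, so contracting it with v leaves a multiple of
    w. *)
Lemma square_form_lower (w v : 'rV[R]_4) (m : 'I_4) :
  \sum_n square_form w m n * v 0 n = pairing w v * w 0 m.
Proof.
rewrite /pairing mxE mulr_suml; apply: eq_bigr => n _.
by rewrite /square_form !mxE big_ord1 !mxE -mulrA mulrC.
Qed.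

Lemma metric_sym (x : 'rV[R]_4) : (metric b x)^T = metric b x.
Proof.
have squareT w : (square_form w)^T = square_form w :> 'M[R]_4.
  by rewrite /square_form trmx_mul trmxK.
have trD : {morph @trmx R 4 4 : C D / C + D} by move=> C D; rewrite linearD.
have trZ k : {morph @trmx R 4 4 : C / k *: C} by move=> C; rewrite linearZ.
by rewrite /metric !(trD, trZ) !squareT.
Qed.

Lemma pairing_basis (k : 'I_4) (v : 'rV[R]_4) : pairing (Defs.basis R k) v = v 0 k.
Proof. by rewrite /pairing /Defs.basis -rowE !mxE. Qed.

Lemma pairing_form1 (x v : 'rV[R]_4) :
  pairing (form1 b x) v = v 0 it - spin b * sin (x 0 ith) ^+ 2 * v 0 iph.
Proof.
rewrite -(pairing_basis it) -(pairing_basis iph) /pairing /form1.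
by rewrite mulmxBl -scalemxAl !mxE.
Qed.

Lemma pairing_form2 (x v : 'rV[R]_4) :
  pairing (form2 b x) v
  = spin b * v 0 it - (x 0 ir ^+ 2 + spin b ^+ 2) * v 0 iph.
Proof.
rewrite -(pairing_basis it) -(pairing_basis iph) /pairing /form2.
by rewrite mulmxBl -!scalemxAl !mxE.
Qed.

Lemma lower_index (x v : 'rV[R]_4) (m : 'I_4) :
  \sum_n metric b x m n * v 0 n =
    - (Delta_r b x / (chi b ^+ 2 * Sigma b x))
      * pairing (form1 b x) v * form1 b x 0 m
    + Delta_th b x * sin (x 0 ith) ^+ 2 / (chi b ^+ 2 * Sigma b x)
      * pairing (form2 b x) v * form2 b x 0 m
    + Sigma b x * ((Delta_r b x)^-1 * v 0 ir * Defs.basis R ir 0 m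
                   + (Delta_th b x)^-1 * v 0 ith * Defs.basis R ith 0 m).
Proof.
have mxE4 (n : 'I_4) : metric b x m n * v 0 n =
    - (Delta_r b x / (chi b ^+ 2 * Sigma b x))
      * (square_form (form1 b x) m n * v 0 n)
    + Delta_th b x * sin (x 0 ith) ^+ 2 / (chi b ^+ 2 * Sigma b x)
      * (square_form (form2 b x) m n * v 0 n)
    + Sigma b x * ((Delta_r b x)^-1 * (square_form (Defs.basis R ir) m n * v 0 n)
                   + (Delta_th b x)^-1 * (square_form (Defs.basis R ith) m n * v 0 n)).
  (* Only sums and scalings are opened entrywise; the entries of [square_form] stay closed for
     [ring]. *)
  have addE (C D : 'M[R]_4) : (C + D) m n = C m n + D m n by rewrite mxE.
  have scaleE k (C : 'M[R]_4) : (k *: C) m n = k * C m n by rewrite mxE.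
  by rewrite /metric !(addE, scaleE); ring.
under eq_bigr do rewrite mxE4.
rewrite !big_split /= -!mulr_sumr big_split /= -!mulr_sumr !square_form_lower.
by rewrite !pairing_basis !mulrA.
Qed.

Lemma form1E (x : 'rV[R]_4) :
  (form1 b x 0 it = 1) * (form1 b x 0 ir = 0) * (form1 b x 0 ith = 0)
  * (form1 b x 0 iph = - (spin b * sin (x 0 ith) ^+ 2)).
Proof. by rewrite /form1 /Defs.basis !mxE /= ?(mulr0, mulr1, subr0, sub0r). Qed.

Lemma form2E (x : 'rV[R]_4) :
  (form2 b x 0 it = spin b) * (form2 b x 0 ir = 0) * (form2 b x 0 ith = 0)
  * (form2 b x 0 iph = - (x 0 ir ^+ 2 + spin b ^+ 2)).
Proof. by rewrite /form2 /Defs.basis !mxE /= ?(mulr0, mulr1, subr0, sub0r). Qed.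

Lemma basisE (k l : 'I_4) : Defs.basis R k 0 l = (l == k)%:R.
Proof. by rewrite mxE. Qed.

(** [- A] and [B] are the coefficients of the lowered vector along [form1] and [form2], the only
    frame forms with t and phi components. *)
Lemma lower_components (x v : 'rV[R]_4) :
  let A := Delta_r b x / (chi b ^+ 2 * Sigma b x) * pairing (form1 b x) v in
  let B := Delta_th b x * sin (x 0 ith) ^+ 2 / (chi b ^+ 2 * Sigma b x)
           * pairing (form2 b x) v in
  [/\ \sum_n metric b x it n * v 0 n = spin b * B - A,
      \sum_n metric b x ir n * v 0 n = Sigma b x / Delta_r b x * v 0 ir,
      \sum_n metric b x ith n * v 0 n = Sigma b x / Delta_th b x * v 0 ith &
      \sum_n metric b x iph n * v 0 n
      = spin b * sin (x 0 ith) ^+ 2 * A - (x 0 ir ^+ 2 + spin b ^+ 2) * B].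
Proof.
move=> A B; rewrite !lower_index !form1E !form2E !basisE /= /A /B; split; ring.
Qed.

Lemma metric_dotE (x v : 'rV[R]_4) :
  metric_dot b x v v =
    - (Delta_r b x / (chi b ^+ 2 * Sigma b x)) * pairing (form1 b x) v ^+ 2
    + Delta_th b x * sin (x 0 ith) ^+ 2 / (chi b ^+ 2 * Sigma b x)
      * pairing (form2 b x) v ^+ 2
    + Sigma b x * (v 0 ir ^+ 2 / Delta_r b x + v 0 ith ^+ 2 / Delta_th b x).
Proof.
have -> : metric_dot b x v v = \sum_m v 0 m * \sum_n metric b x m n * v 0 n.
  apply: eq_bigr => m _; rewrite mulr_sumr; apply: eq_bigr => n _.
  by rewrite mulrA [v 0 m * _]mulrC.
have [gt gr gth gph] := lower_components x v.
rewrite sum4E gt gr gth gph pairing_form1 pairing_form2; ring.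
Qed.

Lemma metric_dot_basis (k : 'I_4) (x v : 'rV[R]_4) :
  metric_dot b x (Defs.basis R k) v = \sum_n metric b x k n * v 0 n.
Proof.
rewrite /metric_dot (bigD1 k) //= [X in _ + X]big1 => [|m mk]; last first.
  by apply: big1 => n _; rewrite basisE (negPf mk) mulr0 mul0r.
by rewrite addr0; apply: eq_bigr => n _; rewrite basisE eqxx mulr1.
Qed.

(** Up to sign this is the determinant of ([form1], [form2]) in (dt, dphi), which is why [Sigma]
    appears whenever the t-phi block is inverted. *)
Lemma SigmaE (x : 'rV[R]_4) :
  Sigma b x
  = x 0 ir ^+ 2 + spin b ^+ 2 - spin b ^+ 2 * sin (x 0 ith) ^+ 2.
Proof. by rewrite /Sigma cos2sin2; ring. Qed.

(** * Nondegeneracy of the metric on the Boyer-Lindquist domain *)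

Lemma BL_domainP (x : 'rV[R]_4) : BL_domain b x ->
  [/\ Sigma b x != 0, Delta_r b x != 0, Delta_th b x != 0 & sin (x 0 ith) != 0].
Proof. by rewrite /BL_domain /= !mulf_eq0 !negb_or -!andbA => /and4P. Qed.

(** Cramer's rule: a * u1 - u2 eliminates dt and equals [Sigma] times the phi component. *)
Lemma pairing_forms_eq0 (x v : 'rV[R]_4) : Sigma b x != 0 ->
  pairing (form1 b x) v = 0 -> pairing (form2 b x) v = 0 ->
  v 0 it = 0 /\ v 0 iph = 0.
Proof.
rewrite pairing_form1 pairing_form2 => S0 u1 u2.
have ph0 : v 0 iph = 0.
  apply: (mulfI S0); rewrite mulr0 SigmaE.
  transitivity (spin b * (v 0 it - spin b * sin (x 0 ith) ^+ 2 * v 0 iph)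
    - (spin b * v 0 it - (x 0 ir ^+ 2 + spin b ^+ 2) * v 0 iph)); first ring.
  by rewrite u1 u2 mulr0 subr0.
by split=> //; move: u1; rewrite ph0 mulr0 subr0.
Qed.

Lemma mulmx_metricE (x v : 'rV[R]_4) (m : 'I_4) :
  (v *m metric b x) 0 m = \sum_n metric b x m n * v 0 n.
Proof.
rewrite mxE; apply: eq_bigr => n _.
by rewrite mulrC -[in LHS]metric_sym mxE.
Qed.

Lemma metric_unit (x : 'rV[R]_4) :
  chi b != 0 -> BL_domain b x -> metric b x \in unitmx.
Proof.
move=> X0 /BL_domainP[S0 Dr0 Dth0 s0].
rewrite -row_free_unit; apply: inj_row_free => v vg.
have g0 m : \sum_n metric b x m n * v 0 n = 0.
  by rewrite -mulmx_metricE vg mxE.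
have [] := lower_components x v; rewrite !g0.
set A := _ * pairing (form1 b x) v; set B := _ * pairing (form2 b x) v.
move=> ht hr hth hph.
(* The lowered t and phi components are combined so that [A] cancels and [Sigma * B] remains. *)
have B0 : B = 0.
  apply: (mulfI S0); rewrite mulr0 SigmaE.
  transitivity (- (spin b * sin (x 0 ith) ^+ 2 * A
    - (x 0 ir ^+ 2 + spin b ^+ 2) * B)
    - spin b * sin (x 0 ith) ^+ 2 * (spin b * B - A)); first ring.
  by rewrite -hph -ht mulr0 oppr0 addr0.
have A0 : A = 0.
  by move: ht; rewrite B0 mulr0 sub0r => /esym/eqP; rewrite oppr_eq0 => /eqP.
have XS0 : chi b ^+ 2 * Sigma b x != 0 by rewrite mulf_neq0 ?expf_neq0.
(* The coefficients of the pairings in [A] and [B] are nonzero; for [B] this takes sin th != 0. *)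
have [] := @pairing_forms_eq0 x v S0.
- by apply: (mulfI (mulf_neq0 Dr0 (invr_neq0 XS0))); rewrite mulr0.
- apply: (mulfI (mulf_neq0 (mulf_neq0 Dth0 (expf_neq0 2 s0)) (invr_neq0 XS0))).
  by rewrite mulr0.
move=> vt vph.
have vr : v 0 ir = 0.
  by apply: (mulfI (mulf_neq0 S0 (invr_neq0 Dr0))); rewrite mulr0.
have vth : v 0 ith = 0.
  by apply: (mulfI (mulf_neq0 S0 (invr_neq0 Dth0))); rewrite mulr0.
apply/rowP => -[[|[|[|[|//]]]] lt4]; rewrite mxE.
- by rewrite -[RHS]vt; congr (v 0 _); apply: val_inj.
- by rewrite -[RHS]vr; congr (v 0 _); apply: val_inj.
- by rewrite -[RHS]vth; congr (v 0 _); apply: val_inj.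
- by rewrite -[RHS]vph; congr (v 0 _); apply: val_inj.
Qed.

(** p - e A is v lowered, so raising it again gives back v. This needs [metric_unit], since [invmx]
    is an inverse only on unit matrices. *)
Lemma two_hamE (e : R) (x v : 'rV[R]_4) :
  chi b != 0 -> BL_domain b x -> two_ham b e x v = metric_dot b x v v.
Proof.
move=> X0 dom; have gU := metric_unit _ X0 dom.
set w := v *m metric b x.
have wE m : momentum b e x v 0 m - e * potential b x 0 m = w 0 m.
  by rewrite /momentum [(\row__ _) _ _]mxE addrK mulmx_metricE.
transitivity ((w *m cometric b x *m w^T) 0 0).
  rewrite mxE; under [RHS]eq_bigr do rewrite mxE mulr_suml.
  rewrite exchange_big /=; apply: eq_bigr => m _; apply: eq_bigr => n _.
  by rewrite !wE [w^T _ _]mxE [w 0 m * _]mulrC.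
rewrite /cometric /w (mulmxK gU) trmx_mul metric_sym mulmxA.
rewrite mxE /metric_dot exchange_big /=; apply: eq_bigr => n _.
rewrite mxE mulr_suml; apply: eq_bigr => m _.
by rewrite [v^T _ _]mxE [v 0 m * _]mulrC.
Qed.

(** * Conserved quantities in terms of the frame *)

Lemma momentumE (e : R) (x v : 'rV[R]_4) (m : 'I_4) :
  momentum b e x v 0 m = \sum_n metric b x m n * v 0 n
    + e * bh_charge b * x 0 ir / (chi b * Sigma b x) * form1 b x 0 m.
Proof.
have scaleE k (w : 'rV[R]_4) : (k *: w) 0 m = k * w 0 m by rewrite mxE.
by rewrite /momentum [(\row__ _) _ _]mxE /potential scaleE !mulrA.
Qed.

Lemma energyE (e : R) (x v : 'rV[R]_4) :
  energy b e x v = - metric_dot b x (Defs.basis R it) v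
                   - e * bh_charge b * x 0 ir / (chi b * Sigma b x).
Proof.
by rewrite metric_dot_basis /energy momentumE form1E mulr1 opprD.
Qed.

Lemma ang_momentumE (e : R) (x v : 'rV[R]_4) :
  ang_momentum b e x v =
    \sum_n metric b x iph n * v 0 n
    - spin b * sin (x 0 ith) ^+ 2
      * (e * bh_charge b * x 0 ir / (chi b * Sigma b x)).
Proof.
by rewrite /ang_momentum momentumE form1E mulrN [X in _ - X]mulrC.
Qed.

(** [W_r] is - chi * p(K) + e Q r for K = (r^2 + a^2) d/dt + a d/dphi. [form2] kills K and [form1]
    takes the value [Sigma] on it, so chi * e * A(K) = e Q r. *)
Lemma W_rE (e : R) (x v : 'rV[R]_4) : chi b != 0 -> Sigma b x != 0 ->
  W_r b e (energy b e x v) (ang_momentum b e x v) x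
  = Delta_r b x * pairing (form1 b x) v / chi b.
Proof.
move=> X0 S0; rewrite /W_r energyE ang_momentumE metric_dot_basis.
have [-> _ _ ->] := lower_components x v.
(* [Sigma] becomes a polynomial in the goal and in its nonvanishing hypothesis alike, so that
   [field] sees the cancellation. *)
move: S0; rewrite SigmaE => S0; field; rewrite exprMn; exact/andP.
Qed.

(** Here the vector is a sin^2 th d/dt + d/dphi: [form1], hence the potential, kills it, and [form2]
    takes the value [- Sigma] on it. *)
Lemma W_thE (e : R) (x v : 'rV[R]_4) :
  chi b != 0 -> Sigma b x != 0 -> sin (x 0 ith) != 0 ->
  W_th b (energy b e x v) (ang_momentum b e x v) x
  = Delta_th b x * sin (x 0 ith) * pairing (form2 b x) v / chi b.
Proof.
move=> X0 S0 s0; rewrite /W_th energyE ang_momentumE metric_dot_basis.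
have [-> _ _ ->] := lower_components x v.
by move: S0; rewrite SigmaE => S0; field; rewrite exprMn X0 S0 s0.
Qed.

(** Subtracting the r and theta terms leaves (Dth sin^2 u2^2 - Dr u1^2) / (chi Sigma)^2. The phi
    term then completes the square of (Dr u1 - a sin^2 Dth u2) / (chi Sigma). *)
Lemma radicandE (x v : 'rV[R]_4) : chi b != 0 -> BL_domain b x ->
  (spin b ^+ 2 * sin (x 0 ith) ^+ 2 * Delta_th b x - Delta_r b x)
    * (metric_dot b x v v / Sigma b x - v 0 ir ^+ 2 / Delta_r b x
       - v 0 ith ^+ 2 / Delta_th b x)
  + v 0 iph ^+ 2 * sin (x 0 ith) ^+ 2 * Delta_r b x * Delta_th b x / chi b ^+ 2
  = (chi b * - metric_dot b x (Defs.basis R it) v) ^+ 2.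
Proof.
move=> X0 /BL_domainP[S0 Dr0 Dth0 s0].
rewrite metric_dotE metric_dot_basis; have [-> _ _ _] := lower_components x v.
have -> : v 0 iph
    = (spin b * pairing (form1 b x) v - pairing (form2 b x) v) / Sigma b x.
  apply: (mulIf S0); rewrite divfK // pairing_form1 pairing_form2 SigmaE; ring.
move: (pairing (form1 b x) v) (pairing (form2 b x) v) => u1 u2.
by field; rewrite X0 S0 Dr0 Dth0.
Qed.

(** Once u1 and u2 are expressed through [W_r] and [W_th], u1 and then E drop out of the bracket,
    leaving chi^2 * L * (Dr - a^2 sin^2 Dth) / sin^2. *)
Lemma ang_momentum_formula (e : R) (x v : 'rV[R]_4) :
  chi b != 0 -> BL_domain b x ->
  Delta_r b x - spin b ^+ 2 * sin (x 0 ith) ^+ 2 * Delta_th b x != 0 ->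
  ang_momentum b e x v =
    sin (x 0 ith) ^+ 2
    / (chi b ^+ 2
       * (Delta_r b x - spin b ^+ 2 * sin (x 0 ith) ^+ 2 * Delta_th b x))
    * (spin b * energy b e x v * chi b ^+ 2 * Delta_r b x
       + Delta_th b x
         * (Sigma b x * Delta_r b x * v 0 iph
            - spin b * chi b * (chi b * energy b e x v
                                  * (x 0 ir ^+ 2 + spin b ^+ 2)
                                + e * bh_charge b * x 0 ir))).
Proof.
move=> X0 /BL_domainP[S0 Dr0 Dth0 s0] D0.
have hr := W_rE e x v X0 S0; have hth := W_thE e x v X0 S0 s0.
move: hr hth D0; rewrite /W_r /W_th.
have -> : Sigma b x * Delta_r b x * v 0 iph = Delta_r b x
    * (spin b * pairing (form1 b x) v - pairing (form2 b x) v).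
  by rewrite pairing_form1 pairing_form2 SigmaE; ring.
set E := energy _ _ _ _; set L := ang_momentum _ _ _ _.
set u1 := pairing _ _; set u2 := pairing _ _; set s := sin _ in s0 *.
set Dr := Delta_r _ _ in Dr0 *; set Dth := Delta_th _ _ in Dth0 *.
set X := chi b in X0 *; set a := spin b.
move=> hr hth D0.
have -> : X * E * (x 0 ir ^+ 2 + a ^+ 2) + e * bh_charge b * x 0 ir
    = Dr * u1 / X + a * X * L by rewrite -hr; ring.
have -> : u2 = X ^+ 2 * (a * E * s - L / s) / (Dth * s).
  apply: (mulfI (mulf_neq0 Dth0 s0)); rewrite mulrC [RHS]mulrC divfK ?mulf_neq0 //.
  transitivity (X * (Dth * s * u2 / X)); first by field.
  by rewrite -hth; ring.
by field; rewrite exprMn D0 X0 s0 Dth0.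
Qed.

Lemma carter_polar (e : R) (x v : 'rV[R]_4) : Delta_th b x != 0 ->
  carter b e x v =
    (W_th b (energy b e x v) (ang_momentum b e x v) x ^+ 2
     + Sigma b x ^+ 2 * v 0 ith ^+ 2) / Delta_th b x
    - two_ham b e x v * spin b ^+ 2 * cos (x 0 ith) ^+ 2.
Proof.
move=> Dth0; rewrite /carter.
have -> : momentum b e x v 0 ith = Sigma b x / Delta_th b x * v 0 ith.
  have [_ _ gth _] := lower_components x v.
  by rewrite momentumE gth form1E mulr0 addr0.
by field.
Qed.

(** Separation of variables: [Sigma] times g(v, v) splits into a radial and a polar part because
    [Sigma] = r^2 + a^2 cos^2 th. *)
Lemma carter_radial (e : R) (x v : 'rV[R]_4) :
  chi b != 0 -> BL_domain b x ->
  carter b e x v =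
    (W_r b e (energy b e x v) (ang_momentum b e x v) x ^+ 2
     - Sigma b x ^+ 2 * v 0 ir ^+ 2) / Delta_r b x
    + two_ham b e x v * x 0 ir ^+ 2.
Proof.
move=> X0 dom; have [S0 Dr0 Dth0 s0] := BL_domainP _ dom.
rewrite carter_polar // W_rE // W_thE // two_hamE //.
have SmuE : metric_dot b x v v * Sigma b x
    = Delta_th b x * sin (x 0 ith) ^+ 2 * pairing (form2 b x) v ^+ 2 / chi b ^+ 2
      - Delta_r b x * pairing (form1 b x) v ^+ 2 / chi b ^+ 2
      + Sigma b x ^+ 2 * (v 0 ir ^+ 2 / Delta_r b x + v 0 ith ^+ 2 / Delta_th b x).
  by rewrite metric_dotE; field; rewrite X0 S0 Dr0 Dth0.
apply/eqP; rewrite -subr_eq0; apply/eqP.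
transitivity (Delta_th b x * sin (x 0 ith) ^+ 2 * pairing (form2 b x) v ^+ 2 / chi b ^+ 2
      - Delta_r b x * pairing (form1 b x) v ^+ 2 / chi b ^+ 2
      + Sigma b x ^+ 2 * (v 0 ir ^+ 2 / Delta_r b x + v 0 ith ^+ 2 / Delta_th b x)
      - metric_dot b x v v * Sigma b x).
  (* Only the [Sigma] multiplying g(v, v) is split; the others stay atomic. *)
  rewrite [in X in _ = _ - _ * X]/Sigma; field.
  by rewrite X0 Dr0 Dth0.
by rewrite SmuE subrr.
Qed.

End Frame.

(** The radicand fixes the kinetic energy only up to sign, hence the two cases for [E]. Its
    nonnegativity is asserted because [Num.sqrt] is 0 on negative numbers. The denominator in [L]
    vanishes exactly where d/dt is null. *)
Theorem proposition3p2p1 (R : realType) (b : KNdS R)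
    (hM : 0 <= bh_mass b) (hQ : 0 <= bh_charge b) (hJ : 0 <= bh_angmom b)
    (hchi : chi b != 0)
    (e : R) (I : set R) (hIopen : open I) (hI : is_interval I)
    (gam : R -> 'rV[R]_4) (hgam : trajectory b e I gam)
    (mu : R) (hmu : mu = -1 \/ mu = 0)
    (hcausal : forall l, I l -> two_ham b e (gam l) (derive1 gam l) = mu) :
  forall l, I l ->
    let a := spin b in
    let x := gam l in
    let v := derive1 gam l in
    let r := x 0 ir in
    let th := x 0 ith in
    let rdot := v 0 ir in
    let thdot := v 0 ith in
    let phdot := v 0 iph in
    let Q := bh_charge b in
    let X := chi b in
    let S := Sigma b x in
    let Dr := Delta_r b x in
    let Dth := Delta_th b x in
    let E := energy b e x v in
    let L := ang_momentum b e x v in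
    let kappa := carter b e x v in
    let rad :=
      (a ^+ 2 * sin th ^+ 2 * Dth - Dr)
        * (mu / S - rdot ^+ 2 / Dr - thdot ^+ 2 / Dth)
      + phdot ^+ 2 * sin th ^+ 2 * Dr * Dth / X ^+ 2 in
    [/\ 0 <= rad,
        future_oriented b x v ->
          E = - (e * Q * r / (X * S)) + X^-1 * Num.sqrt rad
      & ~ future_oriented b x v ->
          E = - (e * Q * r / (X * S)) - X^-1 * Num.sqrt rad]
    /\ (Dr - a ^+ 2 * sin th ^+ 2 * Dth != 0 ->
          L = sin th ^+ 2 / (X ^+ 2 * (Dr - a ^+ 2 * sin th ^+ 2 * Dth))
              * (a * E * X ^+ 2 * Dr
                 + Dth * (S * Dr * phdot
                          - a * X * (X * E * (r ^+ 2 + a ^+ 2) + e * Q * r))))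
    /\ kappa = (W_th b E L x ^+ 2 + S ^+ 2 * thdot ^+ 2) / Dth
               - mu * a ^+ 2 * cos th ^+ 2
    /\ kappa = (W_r b e E L x ^+ 2 - S ^+ 2 * rdot ^+ 2) / Dr + mu * r ^+ 2.
Proof.
move=> l Il a x v r th rdot thdot phdot Q X S Dr Dth E L kappa rad.
have [dom _ _ _] := hgam l Il.
have [_ _ Dth0 _] := BL_domainP _ _ _ dom.
have muE : two_ham b e x v = mu := hcausal l Il.
have radE : rad = (X * - metric_dot b x (Defs.basis R it) v) ^+ 2.
  by rewrite -radicandE // -(two_hamE _ _ e) // muE.
have EE : E = X^-1 * (X * - metric_dot b x (Defs.basis R it) v)
              - e * Q * r / (X * S) by rewrite mulKf // -energyE.
split; [|split; [|split]].
- rewrite radE sqrtr_sqr; split; first exact: sqr_ge0.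
  + by move=> future; rewrite ger0_norm // EE addrC.
  (* Not being future oriented is strict negativity, so the root is minus the kinetic term. *)
  + by move=> /negP; rewrite -ltNge => past; rewrite ltr0_norm // mulrN opprK EE addrC.
- exact: ang_momentum_formula.
- by rewrite -muE; exact: carter_polar.
- by rewrite -muE; exact: carter_radial.
Qed.
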